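(* Let $p>0$. The $p$-energy of a vertex is an imputation of the $p$-energy game that satisfies the axioms of null player, efficiency and symmetry. That is, for every graph $G=(V,E)$ with $V=\{v_1,\dots,v_n\}$, setting $w_p(S)=\mathcal{E}_p(I(S))$ for $S\subset V$: (Imputation) $\mathcal{E}_p(v_i)\geq w_p(\{v_i\})$ for every $i$, and $\sum_{i=1}^n\mathcal{E}_p(v_i)=w_p(V)$ (the latter being also the efficiency axiom); (Null player) if $v_i$ is a null player in $(V,w_p)$, then $\mathcal{E}_p(v_i)=0$; (Symmetry) if $v_i$ and $v_j$ are symmetric players in $(V,w_p)$, then $\mathcal{E}_p(v_i)=\mathcal{E}_p(v_j)$.
   Context: Graphs are finite, simple and undirected. For a graph $G$ with vertices $v_1,\dots,v_n$, the adjacency matrix $A(G)$ is the $n\times n$ matrix with $A_{ij}=1$ if $v_i$ and $v_j$ are adjacent and $A_{ij}=0$ otherwise. For a matrix $M$, $|M|=(MM^* )^{1/2}$. The $p$-energy of $G$ is $\mathcal{E}_p(G)=\operatorname{Tr}(|A(G)|^p)$ (the empty graph has $p$-energy $0$), and the $p$-energy of the vertex $v_i$ of $G$ is $\mathcal{E}_p(v_i)=(|A(G)|^p)_{ii}$. For $S\subset V$, $I(S)$ denotes the subgraph of $G$ induced by $S$. An imputation is a payoff vector that is individually rational and efficient. Players $v_i,v_j$ are symmetric in $(V,w)$ if $w(S\cup\{v_i\})=w(S\cup\{v_j\})$ for every $S\subset V\setminus\{v_i,v_j\}$. A player $v_i$ is null in $(V,w)$ if $w(S\cup\{v_i\})-w(S)=0$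 for every $S\subset V$. *)

(* Defs.v *)
From HB Require Import structures.
From mathcomp Require Import all_boot all_order all_algebra.
From mathcomp Require Import all_classical all_reals all_analysis.
From mathcomp Require Import complex.

Set Implicit Arguments.
Unset Strict Implicit.
Unset Printing Implicit Defensive.

Import Order.TTheory GRing.Theory Num.Theory.
Local Open Scope ring_scope.
Local Open Scope complex_scope.
Local Open Scope sesquilinear_scope.

Record sgraph := SGraph {
  vertex :> finType;
  edge : rel vertex;
  edge_sym : symmetric edge;
  edge_irrefl : irreflexive edge }.

Section Induced.
Variables (G : sgraph) (S : {set G}).

Definition induced_edge : rel {v : G | v \in S} :=
  fun u v => edge (val u) (val v).

Lemma induced_edge_sym : symmetric induced_edge.
Proof. by move=> u v; rewrite /induced_edge edge_sym. Qed.

Lemma induced_edge_irrefl : irreflexive induced_edge.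
Proof. by move=> u; rewrite /induced_edge edge_irrefl. Qed.

Definition induced : sgraph := SGraph induced_edge_sym induced_edge_irrefl.

End Induced.

(* Functional calculus: spectralmx M is unitary, and a normal M                *)
(* equals invmx (spectralmx M) *m diag_mx (spectral_diag M) *m spectralmx M.   *)
(* The value carries no meaning when M is not normal; it is only applied to    *)
(* Hermitian matrices below. mxfunE shows that for normal M it is independent  *)
(* of the chosen unitary diagonalization.                                      *)
Definition mxfun (C : numClosedFieldType) (f : C -> C) n (M : 'M[C]_n) :
    'M[C]_n :=
  invmx (spectralmx M) *m diag_mx (map_mx f (spectral_diag M))
    *m spectralmx M.

Lemma mxfunE (C : numClosedFieldType) (f : C -> C) n (M P : 'M[C]_n)
    (d : 'rV[C]_n) :
  P \is unitarymx -> M = invmx P *m diag_mx d *m P ->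
  mxfun f M = invmx P *m diag_mx (map_mx f d) *m P.
Proof.
move=> uP defM.
have Pu : P \in unitmx by exact: unitarymx_unit.
have nM : M \is normalmx by apply/orthomx_spectral_subproof; exists (P, d).
have Su := spectral_unit M.
have eM := elimT (@orthomx_spectralP _ _ M) nM.
rewrite /mxfun.
move: (spectralmx M) (spectral_diag M) Su eM => S e /= Su eM.
have [Q defQ] : {Q | Q = S *m invmx P} by exists (S *m invmx P).
have QE : Q *m diag_mx d = diag_mx e *m Q.
  have : S *m M *m invmx P = S *m M *m invmx P by [].
  rewrite {1}defM eM !mulmxA mulmxV // mul1mx defQ.
  by rewrite -!mulmxA mulmxV // mulmx1 !mulmxA.
have QfE : Q *m diag_mx (map_mx f d) = diag_mx (map_mx f e) *m Q.
  apply/matrixP => i j; move/matrixP/(_ i j): QE.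
  rewrite !mul_mx_diag !mul_diag_mx !mxE.
  move: (Q i j) => q.
  have [->|qn0] := eqVneq q 0; first by rewrite !mul0r !mulr0.
  by rewrite mulrC => /(mulIf qn0) ->; rewrite mulrC.
have QP : Q *m P = S by rewrite defQ -mulmxA mulVmx // mulmx1.
rewrite -[X in _ *m _ *m X]QP -!mulmxA (mulmxA _ Q) -QfE !mulmxA; congr (_ *m _ *m _).
by rewrite defQ mulmxA mulVmx // mul1mx.
Qed.

Definition mxabs (C : numClosedFieldType) n (M : 'M[C]_n) : 'M[C]_n :=
  mxfun sqrtC (M *m M^t*).

Lemma mxabs_sqr (C : numClosedFieldType) n (M : 'M[C]_n) :
  mxabs M *m mxabs M = M *m M^t*.
Proof.
have hM : M *m M^t* \is hermsymmx.
  apply/is_hermitianmxP; rewrite expr0 scale1r.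
  by rewrite trmx_mul map_mxM map_trmx trmxK -map_mx_comp (map_mx_id (@conjCK _)).
have eM := elimT (@orthomx_spectralP _ _ _) (hermitian_normalmx hM).
rewrite [RHS]eM /mxabs /mxfun; have := spectral_unit (M *m M^t*).
move: (spectralmx _) (spectral_diag _) => S e Su /=.
rewrite !mulmxA mulmxK // -[_ *m diag_mx _ *m diag_mx _]mulmxA mulmx_diag.
by congr (_ *m diag_mx _ *m _); apply/rowP => j; rewrite !mxE -expr2 sqrtCK.
Qed.

Section Energy.
Variable R : realType.

(* The p-th power of a positive semidefinite matrix, whose eigenvalues are     *)
(* nonnegative reals.                                                          *)
Definition mxpow (p : R) n (M : 'M[R[i]]_n) : 'M[R[i]]_n :=
  mxfun (fun z : R[i] => (complex.Re z `^ p)%:C) M.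

Definition adjacency (G : sgraph) : 'M[R[i]]_#|G| :=
  \matrix_(i, j) (edge (enum_val i) (enum_val j))%:R.

Definition absA_pow (p : R) (G : sgraph) : 'M[R[i]]_#|G| :=
  mxpow p (mxabs (adjacency G)).

(* Both quantities are real in R[i] (absA_pow_diag_real, absA_pow_tr_real), so *)
(* taking the real part only changes the type.                                 *)
Definition vertex_energy (p : R) (G : sgraph) (v : G) : R :=
  complex.Re (absA_pow p G (enum_rank v) (enum_rank v)).

Definition energy (p : R) (G : sgraph) : R :=
  complex.Re (\tr (absA_pow p G)).

Lemma absA_pow_diag_real p (G : sgraph) i : absA_pow p G i i \is Num.real.
Proof.
rewrite /absA_pow /mxpow /mxfun invmx_unitary ?spectral_unitarymx //.
rewrite mxE rpred_sum // => k _; rewrite mul_mx_diag !mxE.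
rewrite mulrAC -normCKC rpredM ?rpredX ?normr_real //.
by rewrite complex_real.
Qed.

Lemma absA_pow_tr_real p (G : sgraph) : \tr (absA_pow p G) \is Num.real.
Proof. by apply: rpred_sum => i _; exact: absA_pow_diag_real. Qed.

Definition energy_game (p : R) (G : sgraph) (S : {set G}) : R :=
  energy p (induced S).

End Energy.

Section Game.
Variables (R : realType) (V : finType) (w : {set V} -> R).

Definition individually_rational (x : V -> R) : Prop :=
  forall i, w [set i] <= x i.

Definition efficient (x : V -> R) : Prop := \sum_i x i = w [set: V].

Definition imputation (x : V -> R) : Prop :=
  individually_rational x /\ efficient x.

Definition null_player (i : V) : Prop :=
  forall S : {set V}, w (i |: S) - w S = 0.

Definition symmetric_players (i j : V) : Prop :=
  forall S : {set V}, S \subset ~: [set i; j] -> w (i |: S) = w (j |: S).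

Definition null_player_axiom (x : V -> R) : Prop :=
  forall i, null_player i -> x i = 0.

Definition symmetry_axiom (x : V -> R) : Prop :=
  forall i j, symmetric_players i j -> x i = x j.

End Game.

(* Main.v *)
(* The function |A|^p commutes with any matrix intertwining two adjacency
   matrices.  Hence a vertex energy is unchanged by an embedding of a graph as
   a union of connected components of another one; this covers isomorphisms,
   automorphisms and the inclusion of an isolated vertex.  The game restricted
   to pairs of vertices determines the edges, so a null player is an isolated
   vertex, and two players are symmetric only if exchanging them is an
   automorphism. *)
Require Import Defs.
From mathcomp Require Import all_boot all_order all_algebra.
From mathcomp Require Import perm.
From mathcomp Require Import all_classical all_reals all_analysis.
From mathcomp Require Import complex.

Set Implicit Arguments.
Unset Strict Implicit.
Unset Printing Implicit Defensive.

Import Order.TTheory GRing.Theory Num.Theory.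
Local Open Scope ring_scope.
Local Open Scope complex_scope.
Local Open Scope sesquilinear_scope.

Section FunctionalCalculus.
Variable C : numClosedFieldType.
Implicit Type f : C -> C.

(* In the eigenbases, the intertwining relation reads q d_j = e_i q entrywise,
   so q f(d_j) = f(e_i) q. *)
Lemma mxfun_intertwine f m n (M : 'M[C]_m) (N : 'M[C]_n) (T : 'M[C]_(m, n)) :
  M \is normalmx -> N \is normalmx -> M *m T = T *m N ->
  mxfun f M *m T = T *m mxfun f N.
Proof.
move=> nM nN; have SM := spectral_unit M; have SN := spectral_unit N.
rewrite {1}(elimT (@orthomx_spectralP _ _ M) nM).
rewrite {1}(elimT (@orthomx_spectralP _ _ N) nN) /mxfun.
move: (spectralmx M) (spectral_diag M) (spectralmx N) (spectral_diag N) SM SN.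
move=> S d U e /= Su Uu eT.
pose Q := S *m T *m invmx U.
have QE : diag_mx d *m Q = Q *m diag_mx e.
  have /(congr1 (fun X => S *m X *m invmx U)) := eT.
  by rewrite /Q !mulmxA mulmxV // mul1mx mulmxK.
have QfE : diag_mx (map_mx f d) *m Q = Q *m diag_mx (map_mx f e).
  apply/matrixP => i j; move/matrixP/(_ i j): QE.
  rewrite !mul_mx_diag !mul_diag_mx !mxE; move: (\sum_ _ _) => q.
  have [->|qn0] := eqVneq q 0; first by rewrite !mul0r !mulr0.
  by rewrite [RHS]mulrC => /(mulIf qn0) ->; rewrite mulrC.
have /(congr1 (fun X => invmx S *m X *m U)) := QfE.
by rewrite /Q !mulmxA mulmxKV // mulVmx // mul1mx.
Qed.

(** The identity diagonalizes a scalar matrix, and [mxfunE] allows it in place of the unspecified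
    [spectralmx]. *)
Lemma mxfun_scalar f n (a : C) : mxfun f (a%:M : 'M[C]_n) = (f a)%:M.
Proof.
rewrite (@mxfunE _ f n a%:M 1%:M (const_mx a)).
- by rewrite map_const_mx diag_const_mx invmx1 mul1mx mulmx1.
- by apply/unitarymxP; rewrite trmx1 map_mx1 mulmx1.
- by rewrite diag_const_mx invmx1 mul1mx mulmx1.
Qed.

(** Lets functional calculi be nested, as in the power of [mxabs]. *)
Lemma mxfun_normal f n (M : 'M[C]_n) : mxfun f M \is normalmx.
Proof.
apply/orthomx_spectral_subproof.
exists (spectralmx M, map_mx f (spectral_diag M)) => //=.
exact: spectral_unitarymx.
Qed.

Lemma gram_normal n (M : 'M[C]_n) : M *m M^t* \is normalmx.
Proof.
apply/hermitian_normalmx/is_hermitianmxP; rewrite expr0 scale1r.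
by rewrite trmx_mul map_mxM map_trmx trmxK -map_mx_comp (map_mx_id (@conjCK _)).
Qed.

Lemma mxabs0 n : mxabs (0 : 'M[C]_n) = 0.
Proof.
have E : 0%:M = 0 :> 'M[C]_n := raddf0 _.
by rewrite /mxabs mul0mx -{1}E mxfun_scalar sqrtC0.
Qed.

Lemma mxabs_gram1 n (M : 'M[C]_n) : M *m M^t* = 1%:M -> mxabs M = 1%:M.
Proof. by move=> MM1; rewrite /mxabs MM1 mxfun_scalar sqrtC1. Qed.

End FunctionalCalculus.

Lemma edge_neq (G : sgraph) (u v : G) : edge u v -> u != v.
Proof. by apply: contraTneq => ->; rewrite edge_irrefl. Qed.

Section VertexEnergy.
Variables (R : realType) (p : R).
Implicit Types G H : sgraph.

Lemma adjacency_adj G : (adjacency R G)^t* = adjacency R G.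
Proof. by apply/matrixP => i j; rewrite !mxE rmorph_nat edge_sym. Qed.

Lemma absA_pow_intertwine G H (T : 'M[R[i]]_(#|G|, #|H|)) :
  adjacency R G *m T = T *m adjacency R H ->
  absA_pow p G *m T = T *m absA_pow p H.
Proof.
(* Peel off the power, then the square root; what remains follows by using [AT] twice, since
   adjacency matrices are self-adjoint. *)
move=> AT; apply: mxfun_intertwine; try exact: mxfun_normal.
apply: mxfun_intertwine; try exact: gram_normal.
by rewrite !adjacency_adj -mulmxA AT !mulmxA AT.
Qed.

Lemma energyE G : energy p G = \sum_(v : G) vertex_energy p v.
Proof.
rewrite /energy /mxtrace raddf_sum /=.
rewrite [RHS](reindex _ (onW_bij _ (@enum_val_bij G))) /=.
by apply: eq_bigr => i _; rewrite /vertex_energy enum_valK.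
Qed.

(** In an eigenbasis the diagonal entry is a sum of squared moduli weighted by values of [powR], all
    nonnegative. *)
Lemma vertex_energy_ge0 G (v : G) : 0 <= vertex_energy p v.
Proof.
rewrite /vertex_energy /absA_pow /mxpow /mxfun.
rewrite invmx_unitary ?spectral_unitarymx //.
rewrite mxE raddf_sum /= sumr_ge0 // => k _; rewrite mul_mx_diag !mxE mulrAC.
rewrite -lecR RRe_real; last first.
  by rewrite -normCKC rpredM ?rpredX ?normr_real //= complex_real.
by rewrite -normCKC mulr_ge0 ?exprn_ge0 // lecR powR_ge0.
Qed.

(* [h] embeds [G] as a union of connected components of [H]. *)
Lemma vertex_energy_embed G H (h : G -> H) :
  injective h -> (forall u v, edge (h u) (h v) = edge u v) ->
  (forall u w, edge (h u) w -> exists v, w = h v) ->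
  forall u, vertex_energy p (h u) = vertex_energy p u.
Proof.
move=> h_inj hE h_closed u.
pose T : 'M[R[i]]_(#|G|, #|H|) :=
  \matrix_(i, j) (h (enum_val i) == enum_val j)%:R.
(* Multiplying by [T] on the left selects rows along [h]; on the right, by injectivity, it places
   column [v] at [h v]. *)
have TE M i j : (T *m M) i j = M (enum_rank (h (enum_val i))) j.
  rewrite mxE (bigD1 (enum_rank (h (enum_val i)))) //= mxE enum_rankK eqxx.
  rewrite mul1r big1 ?addr0 // => k kP; rewrite mxE; case: (_ =P enum_val k) kP => [->|].
    by rewrite enum_valK eqxx.
  by rewrite mul0r.
have ET (M : 'M[R[i]]_#|G|) i v : (M *m T) i (enum_rank (h v)) = M i (enum_rank v).
  rewrite mxE (bigD1 (enum_rank v)) //= mxE !enum_rankK eqxx.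
  rewrite mulr1 big1 ?addr0 // => k kP; rewrite mxE enum_rankK.
  case: (_ =P h v) kP => [/h_inj <-|]; first by rewrite enum_valK eqxx.
  by rewrite mulr0.
have AT : adjacency R G *m T = T *m adjacency R H.
  apply/matrixP => i j; rewrite TE !mxE enum_rankK.
  have [/codomP[v hv]|jh] := boolP (enum_val j \in codom h).
    have -> : j = enum_rank (h v) by rewrite -hv enum_valK.
    by have := ET (adjacency R G) i v; rewrite mxE => ->; rewrite mxE !enum_rankK hE.
  (* Outside the image of [h], the column of [T] vanishes, and [h_closed] rules out an edge. *)
  rewrite big1 => [|k _]; last first.
    rewrite [T _ _]mxE; case: eqP => [hk|]; last by rewrite mulr0.
    by case/negP: jh; rewrite -hk codom_f.
  case: (boolP (edge _ _)) => // /h_closed[v jv].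
  by case/negP: jh; rewrite jv codom_f.
have /matrixP/(_ (enum_rank u) (enum_rank (h u))) := absA_pow_intertwine AT.
by rewrite TE ET enum_rankK /vertex_energy => ->.
Qed.

Lemma vertex_energy_component G (S : {set G}) (v : Defs.induced S) :
  (forall u w, u \in S -> edge u w -> w \in S) ->
  vertex_energy p (val v : G) = vertex_energy p v.
Proof.
move=> S_closed; apply: (@vertex_energy_embed (Defs.induced S) G val) => //.
by move=> u w /(S_closed _ _ (valP u)) wS; exists (exist _ w wS).
Qed.

Lemma energy_edgeless G : 0 < p -> (forall u v : G, ~~ edge u v) ->
  energy p G = 0.
Proof.
move=> p_gt0 nG; rewrite /energy /absA_pow.
have -> : adjacency R G = 0 by apply/matrixP => i j; rewrite !mxE (negPf (nG _ _)).
have E : 0%:M = 0 :> 'M[R[i]]_#|G| := raddf0 _.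
(* Positivity of [p] enters here: [powR] sends 0 to 0 for nonzero exponents, but to 1 for exponent
   0. *)
by rewrite mxabs0 /mxpow -E mxfun_scalar /= powR0 ?gt_eqF // E mxtrace0.
Qed.

Lemma energy_game1 G (v : G) : 0 < p -> energy_game p [set v] = 0.
Proof.
move=> p_gt0; apply: energy_edgeless => // -[x xv] [y yv].
rewrite /= /induced_edge /=.
by move: xv yv; rewrite !inE => /eqP -> /eqP ->; rewrite edge_irrefl.
Qed.

(** The adjacency matrix of a single edge squares to the identity, so its absolute value and all
    powers of that are the identity, of trace 2. *)
Lemma energy_game2 G (u v : G) : 0 < p ->
  (energy_game p [set u; v] == 0) = ~~ edge u v.
Proof.
move=> p_gt0; have [uv|nuv] /= := boolP (edge u v); last first.
  apply/eqP/energy_edgeless => // -[x xP] [y yP].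
  rewrite /= /induced_edge /=; move: xP yP; rewrite !inE.
  by case/orP=> /eqP-> /orP[]/eqP->; rewrite ?edge_irrefl // edge_sym.
apply/negbTE; set K := Defs.induced [set u; v].
have cK : #|K| = 2%N by rewrite card_sig cards2 (edge_neq uv).
rewrite /energy_game /energy /absA_pow mxabs_gram1.
  rewrite /mxpow mxfun_scalar /= powR1 mxtrace_scalar -/K cK.
  by rewrite raddfMn /= pnatr_eq0.
rewrite adjacency_adj; apply/matrixP => i j; rewrite !mxE.
rewrite -(inj_eq enum_val_inj) -(inj_eq val_inj).
under eq_bigr do rewrite !mxE.
(* The sum over ordinals becomes one over vertices of [K], then over [u] and [v] in [G], leaving two
   terms. *)
rewrite -(big_enum_val (fun k : K => (edge (enum_val i) k)%:R * (edge k (enum_val j))%:R)) /=.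
move: (enum_val i) (enum_val j) => {i j} [x xP] [y yP] /=.
rewrite /induced_edge /=.
rewrite -(big_sub _ (fun k => (edge x k)%:R * (edge k y)%:R)).
rewrite big_setU1 ?inE ?edge_neq //= big_set1.
have nuv := edge_neq uv; have vu : edge v u by rewrite edge_sym.
move: xP yP; rewrite !inE => /orP[]/eqP-> /orP[]/eqP->;
  rewrite ?edge_irrefl ?uv ?vu ?eqxx ?(negPf nuv) 1?eq_sym ?(negPf nuv);
  by rewrite ?mulr0 ?mul0r ?mulr1 ?addr0 ?add0r.
Qed.

End VertexEnergy.

Theorem proposition4p10 (R : realType) (p : R) (hp : 0 < p) (G : sgraph) :
  [/\ imputation (energy_game p (G := G)) (vertex_energy p (G := G)),
      null_player_axiom (energy_game p (G := G)) (vertex_energy p (G := G)),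
      efficient (energy_game p (G := G)) (vertex_energy p (G := G)) &
      symmetry_axiom (energy_game p (G := G)) (vertex_energy p (G := G))].
Proof.
have eff : efficient (energy_game p (G := G)) (vertex_energy p (G := G)).
  (* The full vertex set is closed under adjacency, so passing to the graph it induces preserves
     vertex energies. *)
  rewrite /efficient /energy_game energyE.
  rewrite (eq_bigl (fun v => v \in [set: G])) => [|v]; last by rewrite inE.
  rewrite big_sub; apply: eq_bigr => v _.
  by apply: vertex_energy_component => u w; rewrite !inE.
split=> //.
- by split=> // v; rewrite energy_game1 // vertex_energy_ge0.
- move=> v v_null; set K := Defs.induced [set v].
  have v_isolated w : edge v w = false.
    have := v_null [set w]; rewrite energy_game1 // subr0 => /eqP.
    by rewrite energy_game2 // => /negbTE.
  pose x : K := exist _ v (set11 v).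
  rewrite -[v]/(val x) vertex_energy_component => [|_ w /set1P->]; last first.
    by rewrite v_isolated.
  (* The energy of the one-vertex component is 0 and is a sum of nonnegative vertex energies, so
     each of them vanishes. *)
  have := energy_game1 v hp; rewrite /energy_game energyE => e0.
  exact: (psumr_eq0P (fun y _ => vertex_energy_ge0 p y) e0).
- move=> u v uv_sym; have [->//|nuv] := eqVneq u v.
  (* Symmetry is applied to the one-player coalition of [k]: the two resulting pairs have equal
     worth, hence both or neither are edges. *)
  have uvE k : k != u -> k != v -> edge u k = edge v k.
    move=> ku kv; apply/negb_inj; rewrite -!(energy_game2 _ _ hp).
    by rewrite uv_sym // finset.sub1set !inE negb_or ku.
  have tE x y : edge (tperm u v x) (tperm u v y) = edge x y.
    case: (tpermP u v x) => [->|->|xu xv]; case: (tpermP u v y) => [->|->|yu yv];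
      rewrite ?edge_irrefl //.
    + exact: edge_sym.
    + by rewrite uvE //; apply/eqP.
    + exact: edge_sym.
    + by rewrite uvE //; apply/eqP.
    + by rewrite ![edge x _]edge_sym uvE //; apply/eqP.
    + by rewrite ![edge x _]edge_sym uvE //; apply/eqP.
  rewrite -[in RHS](tpermL u v).
  rewrite (@vertex_energy_embed R p G G (tperm u v)) //; first exact: perm_inj.
  by move=> x y _; exists (tperm u v y); rewrite tpermK.
Qed.
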